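(* Let $A$ be an arbitrary index set and for each $\alpha\in A$ let $G_\alpha$ be a homeomorphism group of a topological space $X_\alpha$. Then $G_\alpha$ is topologically transitive on $X_\alpha$ for every $\alpha\in A$ if and only if the direct product of groups $G=\prod_{\alpha\in A}G_\alpha$ is topologically transitive on the Tychonoff product of topological spaces $X=\prod_{\alpha\in A}X_\alpha$.
   Context: A homeomorphism group of $X$ is a group of homeomorphisms of $X$ onto itself (no topology on the group is assumed). Every space on which a group acts is assumed to be infinite. The group $G=\prod_\alpha G_\alpha$ (with componentwise multiplication) acts on $X=\prod_\alpha X_\alpha$ canonically, i.e. $\{g_\alpha\}.\{x_\alpha\}=\{g_\alpha.x_\alpha\}$; the Tychonoff product carries the product topology. A homeomorphism group $G$ of $X$ is topologically transitive on $X$ if for all nonempty open subsets $U,V\subset X$ there exists $g\in G$ with $g(U)\cap V\ne\varnothing$. *)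

(* Defs.v *)
From HB Require Import structures.
From mathcomp Require Import all_boot.
From mathcomp Require Import boolp classical_sets functions cardinality filter.
From mathcomp Require Import topology function_spaces.

Set Implicit Arguments.
Unset Strict Implicit.
Unset Printing Implicit Defensive.

Local Open Scope classical_set_scope.

(* Homeomorphisms of X onto itself.  The inverse is a field so that inversion
   is computable; it is determined by the underlying map (see [homeoP]). *)
Record homeo (X : topologicalType) := Homeo {
  homeo_fun :> X -> X;
  homeo_inv : X -> X;
  homeo_funK : cancel homeo_fun homeo_inv;
  homeo_invK : cancel homeo_inv homeo_fun;
  homeo_cts : continuous homeo_fun;
  homeo_inv_cts : continuous homeo_inv
}.

HB.instance Definition _ (X : topologicalType) := gen_eqMixin (homeo X).
HB.instance Definition _ (X : topologicalType) := gen_choiceMixin (homeo X).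

Section HomeoGroup.
Variable X : topologicalType.
Implicit Types f g h : homeo X.

Lemma homeoP f g : (forall x, f x = g x) -> f = g.
Proof.
case: f => f f' fK fK' cf cf'; case: g => g g' gK g'K cg cg' /= fg.
have efg : f = g by apply/funext.
have efg' : f' = g' by apply/funext => x; rewrite -{1}[x]g'K -fg fK.
subst f'; subst f; rewrite (Prop_irrelevance fK gK) (Prop_irrelevance fK' g'K).
by rewrite (Prop_irrelevance cf cg) (Prop_irrelevance cf' cg').
Qed.

Let cts_comp (f g : X -> X) : continuous f -> continuous g ->
  continuous (f \o g).
Proof. by move=> cf cg x; apply: continuous_comp; [exact: cg | exact: cf]. Qed.

Definition homeo_id : homeo X :=
  @Homeo X id id (fun=> erefl) (fun=> erefl)
    (fun=> cvg_id) (fun=> cvg_id).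

Definition homeo_comp f g : homeo X :=
  @Homeo X (f \o g) (homeo_inv g \o homeo_inv f)
    (can_comp (homeo_funK f) (homeo_funK g))
    (can_comp (homeo_invK g) (homeo_invK f))
    (cts_comp (@homeo_cts _ f) (@homeo_cts _ g))
    (cts_comp (@homeo_inv_cts _ g) (@homeo_inv_cts _ f)).

Definition homeo_opp f : homeo X :=
  @Homeo X (homeo_inv f) f (homeo_invK f) (homeo_funK f)
    (@homeo_inv_cts _ f) (@homeo_cts _ f).

Fact homeo_compA : associative homeo_comp.
Proof. by move=> f g h; apply: homeoP. Qed.
Fact homeo_comp1f : left_id homeo_id homeo_comp.
Proof. by move=> f; apply: homeoP. Qed.
Fact homeo_compf1 : right_id homeo_id homeo_comp.
Proof. by move=> f; apply: homeoP. Qed.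
Fact homeo_compVf : left_inverse homeo_id homeo_opp homeo_comp.
Proof. by move=> f; apply: homeoP => x; exact: homeo_funK. Qed.
Fact homeo_compfV : right_inverse homeo_id homeo_opp homeo_comp.
Proof. by move=> f; apply: homeoP => x; exact: homeo_invK. Qed.

HB.instance Definition _ := isGroup.Build (homeo X)
  homeo_compA homeo_comp1f homeo_compf1 homeo_compVf homeo_compfV.

End HomeoGroup.

(* A homeomorphism group of X is a subgroup [G : groupClosed (homeo X)];
   [group_of G] is the abstract group carried by G. *)
Definition group_of (X : topologicalType) (G : groupClosed (homeo X)) : Type :=
  {g : homeo X | g \in G}.

Section GroupOf.
Variables (X : topologicalType) (G : groupClosed (homeo X)).

HB.instance Definition _ := SubChoice.on (group_of G).

Fact group_of_closed : group_closed (G : {pred homeo X}).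
Proof. by split; [exact: gpred1 | move=> x y; exact: gpredF]. Qed.

HB.instance Definition _ :=
  SubChoice_isSubGroup.Build _ _ (group_of G) group_of_closed.

Definition natural_action : {multiplicative group_of G -> homeo X} := val.

End GroupOf.

Definition direct_product (A : Type) (H : A -> groupType) : Type :=
  forall a, H a.

Section DirectProduct.
Variables (A : Type) (H : A -> groupType).
Implicit Types g h k : direct_product H.

HB.instance Definition _ := gen_eqMixin (direct_product H).
HB.instance Definition _ := gen_choiceMixin (direct_product H).

Definition dprod_one : direct_product H := fun a => 1%g.
Definition dprod_mul g h : direct_product H := fun a => (g a * h a)%g.
Definition dprod_inv g : direct_product H := fun a => (g a)^-1%g.

Fact dprod_mulA : associative dprod_mul.
Proof. by move=> g h k; apply: functional_extensionality_dep => a; exact: mulgA. Qed.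
Fact dprod_mul1g : left_id dprod_one dprod_mul.
Proof. by move=> g; apply: functional_extensionality_dep => a; exact: mul1g. Qed.
Fact dprod_mulg1 : right_id dprod_one dprod_mul.
Proof. by move=> g; apply: functional_extensionality_dep => a; exact: mulg1. Qed.
Fact dprod_mulVg : left_inverse dprod_one dprod_inv dprod_mul.
Proof. by move=> g; apply: functional_extensionality_dep => a; exact: mulVg. Qed.
Fact dprod_mulgV : right_inverse dprod_one dprod_inv dprod_mul.
Proof. by move=> g; apply: functional_extensionality_dep => a; exact: mulgV. Qed.

HB.instance Definition _ := isGroup.Build (direct_product H)
  dprod_mulA dprod_mul1g dprod_mulg1 dprod_mulVg dprod_mulgV.

End DirectProduct.

Section ProductAction.
Variables (A : Type) (X : A -> topologicalType).

Lemma prod_map_cts (f : forall a, X a -> X a) :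
  (forall a, continuous (f a)) ->
  continuous (fun x : prod_topology X => (fun a => f a (x a)) : prod_topology X).
Proof.
set F : prod_topology X -> prod_topology X := fun x => _ => cf x.
have FF : Filter (F y @[y --> x])
  by exact: (@fmap_filter _ _ F (nbhs x) (nbhs_filter x)).
apply/cvg_sup => a.
have prc : {for x, continuous (fun y : prod_topology X => y a)}.
  have /cvg_sup/(_ a) ha : x --> x by exact: cvg_id.
  move=> V Va; apply: ha.
  exact: (@initial_continuous _ _ (fun y : prod_topology X => y a) x V Va).
have prfc : {for x, continuous (fun y : prod_topology X => f a (y a))}.
  by apply: (continuous_comp prc); exact: cf.
move=> V /= [B [[C oC CB] Bx] BV]; apply: filterS BV _.
rewrite -CB; apply: (prfc C); apply: open_nbhs_nbhs; split=> //.
by move: Bx; rewrite -CB.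
Qed.

Variable G : forall a, groupClosed (homeo (X a)).

Let GG : groupType := direct_product (fun a => group_of (G a)).

Definition prod_map (g : GG) (x : prod_topology X) : prod_topology X :=
  fun a => natural_action (G a) (g a) (x a).

Fact prod_mapK (g : GG) : cancel (prod_map g) (prod_map g^-1%g).
Proof.
move=> x; apply: functional_extensionality_dep => a; exact: homeo_funK.
Qed.

Fact prod_mapKV (g : GG) : cancel (prod_map g^-1%g) (prod_map g).
Proof.
move=> x; apply: functional_extensionality_dep => a; exact: homeo_invK.
Qed.

Fact prod_map_continuous (g : GG) : continuous (prod_map g).
Proof.
apply: (@prod_map_cts (fun a => natural_action (G a) (g a))) => a.
exact: homeo_cts.
Qed.

Definition prod_homeo (g : GG) : homeo (prod_topology X) :=
  Homeo (prod_mapK g) (prod_mapKV g)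
    (@prod_map_continuous g) (@prod_map_continuous g^-1%g).

Fact prod_homeoM : {morph prod_homeo : g h / (g * h)%g}.
Proof. by move=> g h; apply: homeoP. Qed.

HB.instance Definition _ := isMultiplicative.Build _ _ prod_homeo prod_homeoM.

Definition product_action : {multiplicative GG -> homeo (prod_topology X)} :=
  prod_homeo.

(* When no X a is empty the action is faithful, so that the direct product
   is (isomorphic to) a homeomorphism group of the product. *)
Lemma product_action_inj :
  (forall a, [set: X a] !=set0) -> injective product_action.
Proof.
move=> X0 g h gh; apply: functional_extensionality_dep => a.
apply/val_inj/homeoP => y.
have [x xa] : exists x : prod_topology X, x a = y.
  have /(_ _)/cid pt b : exists z : X b, forall e : a = b, z = ecast b (X b) e y.
    have [e|ne] := pselect (a = b).
      by exists (ecast b (X b) e y) => e'; rewrite (Prop_irrelevance e' e).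
    by have [z _] := X0 b; exists z => e; case: (ne e).
  by exists (fun b => sval (pt b)); rewrite (svalP (pt a) erefl).
have /(congr1 (fun k : homeo _ => (k : _ -> _) x a)) := gh.
by rewrite /= /prod_map xa.
Qed.

End ProductAction.

(* Topological transitivity of a group H acting on X by homeomorphisms through
   rho; for a homeomorphism group G of X, rho is [natural_action G]. *)
Definition topologically_transitive (H : groupType) (X : topologicalType)
    (rho : {multiplicative H -> homeo X}) : Prop :=
  forall U V : set X, open U -> open V -> U !=set0 -> V !=set0 ->
    exists g : H, (rho g @` U) `&` V !=set0.

(* Main.v *)
(** Only boxes inside the open sets [U] and [V] matter. If a box of open
    sets around a point of [U] and a box around a point of [V] are chosen,
    transitivity in each coordinate gives [g a] moving a point of the [a]-th side
    of the first to the [a]-th side of the second, and the choices for all [a]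
    are assembled into one element of the full direct product.
    Conversely, transitivity passes to the factors by pulling open sets back
    along the projections, which are onto because no factor is empty. *)

Require Import Defs.
From mathcomp Require Import all_boot.
From mathcomp Require Import boolp classical_sets functions cardinality filter.
From mathcomp Require Import topology function_spaces.

Local Open Scope classical_set_scope.

Section Product.
Context {A : Type} {X : A -> topologicalType}.

(* The library equips products with projections and updates over an [eqType];
   [{classic A}] is [A] with classically decided equality. *)
Lemma prod_coord_continuous (a : A) :
  continuous (fun x : prod_topology X => x a).
Proof. exact: (@proj_continuous {classic A} X a). Qed.

Lemma prod_coord_surj (a : A) (y : X a) :
  (forall b, [set: X b] !=set0) -> exists x : prod_topology X, x a = y.
Proof.
move=> /(_ _)/cid X0.
exists (@dfwith {classic A} X (fun b => sval (X0 b)) a y).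
exact: (@dfwith_in {classic A} X).
Qed.

(** The neighbourhood filter of [x] in the box topology. *)
Definition in_open_box (x : prod_topology X) : set_system (prod_topology X) :=
  [set U | exists W : forall a, set (X a),
     [/\ forall a, open (W a), forall a, W a (x a) &
         forall y : prod_topology X, (forall a, W a (y a)) -> U y]].

Lemma in_open_box_filter x : Filter (in_open_box x).
Proof.
split.
- by exists (fun=> setT); split=> // a; exact: openT.
- move=> U V [W [oW Wx WU]] [W' [oW' W'x W'V]].
  exists (fun a => W a `&` W' a); split=> [a|a|y Wy]; first exact: openI.
    by split.
  by split; [apply: WU => a; case: (Wy a) | apply: W'V => a; case: (Wy a)].
- move=> U V UV [W [oW Wx WU]]; exists W; split=> // y Wy.
  by apply: UV; exact: WU.
Qed.

(* Only boxes with finitely many proper sides are neighbourhoods, but the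
   finiteness is not needed: the box filter is finer than that of [nbhs x]. *)
Lemma nbhs_in_open_box (x : prod_topology X) : nbhs x `<=` in_open_box x.
Proof.
have FF := in_open_box_filter x.
(* The product topology is a supremum of initial topologies, so this convergence can be tested one
   coordinate at a time. *)
suff : in_open_box x --> x by [].
apply/cvg_sup => a V /= [B [[C oC CB] Bx] BV].
pose W := @dfwith {classic A} (set \o X) (fun=> setT) a C.
have WE : W a = C by exact: (@dfwith_in {classic A}).
exists W; split=> [b|b|y Wy].
- rewrite /W; case: (@dfwithP {classic A} (set \o X) (fun=> setT) a C b) => //.
  by move=> b' _; exact: openT.
- rewrite /W; case: (@dfwithP {classic A} (set \o X) (fun=> setT) a C b) => //.
  by move: Bx; rewrite -CB.
- by apply: BV; rewrite -CB /= -WE; exact: Wy.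
Qed.

End Product.

Theorem theorem3p2 (A : Type) (X : A -> topologicalType)
    (X_infinite : forall a : A, infinite_set [set: X a])
    (G : forall a : A, groupClosed (homeo (X a))) :
  (forall a : A, topologically_transitive (natural_action (G a))) <->
  topologically_transitive (product_action G).
Proof.
have X0 a : [set: X a] !=set0.
  by apply/set0P/negP => /eqP XE; apply: (X_infinite a); rewrite XE.
split=> [tG U V oU oV [u Uu] [v Vv]|tG a U V oU oV [u Uu] [v Vv]].
  have [WU [oWU WUu WUU]] := nbhs_in_open_box u U (open_nbhs_nbhs (conj oU Uu)).
  have [WV [oWV WVv WVV]] := nbhs_in_open_box v V (open_nbhs_nbhs (conj oV Vv)).
  (* A point is chosen along with each group element: these points are the coordinates of a single
     point of [U] that the assembled element moves into [V]. *)
  have /(_ _)/cid gx a : exists gx : group_of (G a) * X a,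
      WU a gx.2 /\ WV a (natural_action (G a) gx.1 gx.2).
    have [//|//|g [_ [[x Ux <-] Vx]]] := tG a _ _ (oWU a) (oWV a).
    - by exists (u a).
    - by exists (v a).
    - by exists (g, x).
  pose x : prod_topology X := fun a => (sval (gx a)).2.
  exists (fun a => (sval (gx a)).1).
  exists (prod_map (fun a => (sval (gx a)).1) x); split.
    by exists x => //; apply: WUU => a; case: (svalP (gx a)).
  by apply: WVV => a; case: (svalP (gx a)).
have [xu xuE] := prod_coord_surj a u X0; have [xv xvE] := prod_coord_surj a v X0.
have op W : open W -> open [set x : prod_topology X | W (x a)].
  by move=> oW; apply: open_comp oW => x _; exact: prod_coord_continuous.
have [||g [_ [[x Ux <-] Vx]]] := tG _ _ (op _ oU) (op _ oV).
- by exists xu; rewrite /= xuE.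
- by exists xv; rewrite /= xvE.
- by exists (g a), (natural_action (G a) (g a) (x a)); split; first exists (x a).
Qed.
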